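(* Let $ABC$ be an anticlockwise oriented triangle and let a circle $\Gamma$ with centre $O$ meet the sides $BC$, $CA$, $AB$ at $\{A_1,A_2\}$, $\{B_1,B_2\}$, $\{C_1,C_2\}$ respectively. Let $P$ and $Q$ be the Miquel points of $\triangle A_1B_1C_1$ and $\triangle A_2B_2C_2$ in $\triangle ABC$, respectively, and put $T_A=PA_1\cap QA_2$, $T_B=PB_1\cap QB_2$, $T_C=PC_1\cap QC_2$. Then the line through $A$ parallel to $T_BT_C$, the line through $B$ parallel to $T_CT_A$, and the line through $C$ parallel to $T_AT_B$ are concurrent at a point of the circumcircle $\odot(ABC)$.
   Context: All objects lie in the Euclidean plane; $\odot(XYZ)$ denotes the circumcircle of $\triangle XYZ$. The two labels on each side may be assigned in either order. Miquel point: if $D,E,F$ lie on the lines $BC,CA,AB$ respectively, the Miquel point of $\triangle DEF$ in $\triangle ABC$ is the common point of $\odot(AEF)$, $\odot(BFD)$, $\odot(CDE)$. Coincidences are read in the limiting sense: if, e.g., $B_1=A\neq C_1$, then $\odot(AB_1C_1)$ means the circle through $A$ and $C_1$ tangent to line $CA$ at $A$ (and similarly in the other cases). The configuration is assumed nondegenerate, so that every named object exists and is uniquely determined: no circle above has all three of its defining points equal, $P\neq Q$, $P\notin\{A_1,B_1,C_1\}$, $Q\notin\{A_2,B_2,C_2\}$, and the pairs of lines defining $T_A,T_B,T_C$ are distinct and not parallel. *)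

(* Defs.v *)
(* Plane geometry over Stdlib's classical real numbers. *)
From Stdlib Require Import Reals.
Open Scope R_scope.

Record point : Set := Point { px : R; py : R }.

Record circle : Set :=
  Circle { center : point; radius : R; radius_pos : 0 < radius }.

Definition on_circle (w : circle) (X : point) : Prop :=
  dist_euc (px X) (py X) (px (center w)) (py (center w)) = radius w.

(* The cross product and the dot product of the vectors XY and ZW. *)
Definition cross (X Y Z W : point) : R :=
  (px Y - px X) * (py W - py Z) - (py Y - py X) * (px W - px Z).

Definition dot (X Y Z W : point) : R :=
  (px Y - px X) * (px W - px Z) + (py Y - py X) * (py W - py Z).

Definition anticlockwise (A B C : point) : Prop := 0 < cross A B A C.

(* [on_line Y Z X]: X lies on the line YZ, for Y <> Z. *)
Definition on_line (Y Z X : point) : Prop := cross Y Z Y X = 0.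

(* The lines XY and ZW have the same direction, for X <> Y and Z <> W.
   Equal lines count as parallel. *)
Definition parallel (X Y Z W : point) : Prop := cross X Y Z W = 0.

(* X is the intersection point of the lines YZ and UV, which are required to
   be well defined, distinct and not parallel. *)
Definition is_intersection (Y Z U V X : point) : Prop :=
  Y <> Z /\ U <> V /\ ~ parallel Y Z U V /\ on_line Y Z X /\ on_line U V X.

(* X lies on the line through A parallel to the line UV.  The condition
   U <> V says that the line UV exists. *)
Definition on_parallel_through (A U V X : point) : Prop :=
  U <> V /\ cross U V A X = 0.

(* The line YZ touches the circle w at the point X. *)
Definition tangent_at (w : circle) (Y Z X : point) : Prop :=
  on_circle w X /\ on_line Y Z X /\ dot (center w) X Y Z = 0.

Definition is_circumcircle (X Y Z : point) (w : circle) : Prop :=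
  on_circle w X /\ on_circle w Y /\ on_circle w Z.

(* w is the circle VEF, for E on the line VY and F on the line VZ, where V, Y, Z
   are not collinear and E, F are not both equal to V.  If E = V (or F = V),
   this is the limiting circle, tangent to VY (or to VZ) at V.  E = F <> V cannot
   occur, as the lines VY and VZ meet only at V. *)
Definition is_limit_circle (V Y Z E F : point) (w : circle) : Prop :=
  is_circumcircle V E F w /\
  (E = V -> tangent_at w V Y V) /\
  (F = V -> tangent_at w V Z V).

(* None of the circles AEF, BFD, CDE has three equal defining points. *)
Definition nondegenerate_circles (A B C D E F : point) : Prop :=
  ~ (E = A /\ F = A) /\ ~ (F = B /\ D = B) /\ ~ (D = C /\ E = C).

Definition is_miquel_point (A B C D E F P : point) : Prop :=
  on_line B C D /\ on_line C A E /\ on_line A B F /\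
  exists wA wB wC : circle,
    is_limit_circle A C B E F wA /\
    is_limit_circle B A C F D wB /\
    is_limit_circle C B A D E wC /\
    on_circle wA P /\ on_circle wB P /\ on_circle wC P.

(* The circle w meets the line YZ exactly at X1 and X2; X1 = X2 means that
   the line is tangent to w. *)
Definition meets_line_at (w : circle) (Y Z X1 X2 : point) : Prop :=
  forall X : point, (on_circle w X /\ on_line Y Z X) <-> (X = X1 \/ X = X2).

(* Main.v *)
(* The limit-circle conditions say that PA1, PB1, PC1 make one directed angle
   with BC, CA, AB; let t be its cotangent (signed distances show that P lies on
   no side line, so t is finite), and s the analogous cotangent for Q.  The
   midpoint of A1A2 is the foot of O on BC, and cyclically; if s + t were not 0
   these three linear relations would give a point on all three side lines.  So
   s = - t.  Then TA, TB, TC lie on a circle through P and Q, and TB TC has the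
   direction isogonal, in the angle A, to that of PQ (written out with complex
   numbers as conj(PQ) * CA * AB).  The three parallels therefore meet at the
   isogonal conjugate of the point at infinity of PQ, which lies on the
   circumcircle. *)
Require Import Defs.
From Stdlib Require Import Reals Lra Nsatz.
Open Scope R_scope.

(** * Circles, lines and chords in coordinates *)

Ltac coords := unfold parallel, on_line, cross, dot in *; simpl in *.

Lemma on_circle_sqr (w : circle) (X : point) :
  on_circle w X <-> dot (center w) X (center w) X = radius w ^ 2.
Proof.
  unfold on_circle, dist_euc.
  set (q := _ + _).
  assert (hq : q = dot (center w) X (center w) X) by (unfold q, dot, Rsqr; ring).
  assert (0 <= q) by (apply Rplus_le_le_0_compat; apply Rle_0_sqr).
  pose proof (radius_pos w) as Hr.
  rewrite <- hq; clearbody q; split; intro H0.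
  - now rewrite <- H0, pow2_sqrt.
  - rewrite H0; apply sqrt_pow2; lra.
Qed.

Lemma dot_self_pos (Y Z : point) : Y <> Z -> 0 < dot Y Z Y Z.
Proof.
  intro H; unfold dot; fold (Rsqr (px Z - px Y)) (Rsqr (py Z - py Y)).
  destruct (Req_dec (px Y) (px Z)) as [Hx|Hx].
  - apply Rplus_le_lt_0_compat; [apply Rle_0_sqr | apply Rsqr_pos_lt].
    intro Hy; apply H; destruct Y, Z; simpl in *; f_equal; lra.
  - apply Rplus_lt_le_0_compat; [apply Rsqr_pos_lt; lra | apply Rle_0_sqr].
Qed.

Lemma on_line_param (Y Z X : point) :
  Y <> Z -> on_line Y Z X ->
  exists e, px X = px Y + e * (px Z - px Y) /\ py X = py Y + e * (py Z - py Y).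
Proof.
  intros H HX; apply dot_self_pos, Rgt_not_eq in H.
  set (e := dot Y X Y Z / dot Y Z Y Z).
  assert (he : e * dot Y Z Y Z = dot Y X Y Z) by (unfold e; field; exact H).
  exists e; clearbody e; split; apply Rmult_eq_reg_l with (2 := H);
    clear H; coords; nsatz.
Qed.

(** Symmetry in the perpendicular from the centre: the mirror image of [X1] is again a common point,
    so the exactness of [meets_line_at] makes it [X1] or [X2]. *)
Lemma meets_line_at_midpoint (w : circle) (Y Z X1 X2 : point) :
  Y <> Z -> meets_line_at w Y Z X1 X2 ->
  dot (center w) X1 Y Z + dot (center w) X2 Y Z = 0.
Proof.
  intros HYZ H.
  destruct (proj2 (H X1) (or_introl eq_refl)) as [h1 l1].
  destruct (proj2 (H X2) (or_intror eq_refl)) as [h2 l2].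
  apply on_circle_sqr in h1, h2.
  destruct (on_line_param Y Z X1 HYZ l1) as [a [ax ay]].
  destruct (on_line_param Y Z X2 HYZ l2) as [b [bx by_]].
  pose proof (dot_self_pos Y Z HYZ) as Hn.
  (* The mirror image of [X1] in the perpendicular from the centre. *)
  set (m := 2 * dot (center w) X1 Y Z / dot Y Z Y Z).
  assert (Hm : m * dot Y Z Y Z = 2 * dot (center w) X1 Y Z)
    by (unfold m; field; lra).
  clearbody m.
  set (X := Point (px X1 - m * (px Z - px Y)) (py X1 - m * (py Z - py Y))).
  assert (HX : X = X1 \/ X = X2).
  { apply H; split.
    - apply on_circle_sqr; rewrite <- h1.
      clear - Hm; unfold X; coords; nsatz.
    - clear - l1; unfold X; coords; nsatz. }
  destruct HX as [HX|HX].
  (* Tangent case: [X1] is the foot of the centre, and by Pythagoras [X2], equally far from the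
     centre, coincides with it. *)
  - pose proof (f_equal px HX) as ex; pose proof (f_equal py HX) as ey.
    apply Rgt_not_eq in Hn.
    assert (Hm0 : m * dot Y Z Y Z = 0)
      by (clear - ex ey; unfold X in *; coords; nsatz).
    rewrite Hm0 in Hm.
    assert (Hab : (b - a) ^ 2 * dot Y Z Y Z = 0)
      by (clear - Hm h1 h2 ax ay bx by_; coords; nsatz).
    apply Rmult_integral in Hab; destruct Hab as [Hab|]; [|tauto].
    assert (b = a) by nra.
    subst b; clear - Hm ax ay bx by_; coords; nsatz.
  - rewrite <- HX; clear - Hm; unfold X; coords; nsatz.
Qed.

(** * Directed angles at a Miquel point *)

(* The tangency condition at [E = V] is exactly what keeps this chord formula
   valid after division by the vanishing length. *)
Lemma limit_chord (w : circle) (V Y E : point) :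
  V <> Y -> on_line V Y E -> on_circle w V -> on_circle w E ->
  (E = V -> tangent_at w V Y V) ->
  2 * dot V (center w) V Y = dot V E V Y.
Proof.
  intros HVY HE hV hE ht.
  destruct (on_line_param V Y E HVY HE) as [e [ex ey]].
  apply on_circle_sqr in hV, hE.
  destruct (Req_dec e 0) as [->|He].
  - assert (EV : E = V).
    { destruct E, V; simpl in *; f_equal; lra. }
    destruct (ht EV) as [_ [_ h]]; subst E; clear - h; coords; nsatz.
  - apply Rmult_eq_reg_l with (2 := He); clear - hV hE ex ey; coords; nsatz.
Qed.

(* Equality of the directed angles (PE, VY) and (PF, VZ). *)
Lemma limit_circle_angle (V Y Z E F P : point) (w : circle) :
  cross V Y V Z <> 0 -> on_line V Y E -> on_line V Z F ->
  is_limit_circle V Y Z E F w -> on_circle w P ->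
  cross V Y V P * dot P F V Z = cross V Z V P * dot P E V Y.
Proof.
  intros Hn HE HF [[hV [hE hF]] [tE tF]] hP.
  assert (nY : V <> Y) by (intros ->; apply Hn; coords; ring).
  assert (nZ : V <> Z) by (intros ->; apply Hn; coords; ring).
  pose proof (limit_chord w V Y E nY HE hV hE tE) as kY.
  pose proof (limit_chord w V Z F nZ HF hV hF tF) as kZ.
  apply on_circle_sqr in hV, hP.
  assert (kP : 2 * dot V (center w) V P = dot V P V P)
    by (clear - hV hP; coords; nsatz).
  (* The three chord relations are linear in the centre; the linear dependence of the vectors VY,
     VZ, VP eliminates it. *)
  clear - kY kZ kP; coords; nsatz.
Qed.

Lemma triangle_sides_neq (A B C : point) :
  anticlockwise A B C -> B <> C /\ C <> A /\ A <> B.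
Proof.
  unfold anticlockwise; intro h; repeat split; intros ->; coords; lra.
Qed.

(* [t] is the cotangent of the directed angle from each side line to the line
   joining the Miquel point with the point on that side. *)
Lemma miquel_cotangent (A B C D E F P : point) :
  anticlockwise A B C -> is_miquel_point A B C D E F P ->
  P <> D -> P <> E -> P <> F ->
  exists t,
    (cross B C B P <> 0 /\ dot P D B C = t * cross B C B P) /\
    (cross C A C P <> 0 /\ dot P E C A = t * cross C A C P) /\
    (cross A B A P <> 0 /\ dot P F A B = t * cross A B A P).
Proof.
  intros h [lD [lE [lF [wA [wB [wC [HA [HB [HC [pA [pB pC]]]]]]]]]]] nD nE nF.
  destruct (triangle_sides_neq A B C h) as [nBC [nCA nAB]].
  unfold anticlockwise in h.
  apply (fun n a b => limit_circle_angle A C B E F P wA n a b HA) in pA;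
    [| coords; lra | coords; lra | coords; lra].
  apply (fun n a b => limit_circle_angle B A C F D P wB n a b HB) in pB;
    [| coords; lra | coords; lra | coords; lra].
  apply (fun n a b => limit_circle_angle C B A D E P wC n a b HC) in pC;
    [| coords; lra | coords; lra | coords; lra].
  (* If [P] is on a side line, the vector PX runs along that line, so its dot product with the side
     cannot vanish too. *)
  assert (key : forall Y Z X, Y <> Z -> on_line Y Z X -> P <> X ->
            cross Y Z Y P = 0 -> dot P X Y Z <> 0).
  { intros Y Z X HYZ HX HP h0 h1.
    apply dot_self_pos in HP.
    pose proof (dot_self_pos Y Z HYZ) as Hn.
    assert (dot P X P X * dot Y Z Y Z = 0) by (clear - HX h0 h1; coords; nsatz).
    nra. }
  pose proof (key B C D nBC lD nD) as kD.
  pose proof (key C A E nCA lE nE) as kE.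
  pose proof (key A B F nAB lF nF) as kF.
  (* Doubled signed areas: they add up to that of ABC, so at least one is nonzero. *)
  assert (hs : cross B C B P + cross C A C P + cross A B A P = cross A B A C)
    by (coords; ring).
  assert (qA : cross C A C P * dot P F A B = cross A B A P * dot P E C A)
    by (clear - pA; coords; nsatz).
  assert (qB : cross A B A P * dot P D B C = cross B C B P * dot P F A B)
    by (clear - pB; coords; nsatz).
  assert (qC : cross B C B P * dot P E C A = cross C A C P * dot P D B C)
    by (clear - pC; coords; nsatz).
  clear pA pB pC key HA HB HC.
  set (x := cross B C B P) in *; set (y := cross C A C P) in *;
    set (z := cross A B A P) in *.
  set (d := dot P D B C) in *; set (e := dot P E C A) in *;
    set (f := dot P F A B) in *.
  clearbody x y z d e f.
  assert (xyz : x <> 0 /\ y <> 0 /\ z <> 0).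
  { assert (x <> 0 \/ y <> 0 \/ z <> 0).
    { destruct (Req_dec x 0); [|tauto]. destruct (Req_dec y 0); [|tauto].
      right; right; lra. }
    (* If one of them vanishes, then so do all, as [(x, d)], [(y, e)], [(z, f)]
       are nonzero and pairwise proportional. *)
    assert (prop : forall a b u v, (a = 0 -> u <> 0) -> a * v = b * u ->
              a = 0 -> b = 0).
    { intros a b u v ha hv h0; specialize (ha h0); subst a.
      rewrite Rmult_0_l in hv; symmetry in hv.
      apply Rmult_integral in hv; tauto. }
    pose proof (prop y z e f kE qA) as yz.
    pose proof (prop z x f d kF qB) as zx.
    pose proof (prop x y d e kD qC) as xy.
    tauto. }
  destruct xyz as [hx [hy hz]].
  exists (d / x); repeat split; trivial.
  - field; trivial.
  - apply Rmult_eq_reg_l with (2 := hx); rewrite qC; field; trivial.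
  - apply Rmult_eq_reg_l with (2 := hx); rewrite <- qB; field; trivial.
Qed.

(* If [t + s <> 0], the six relations make a single point lie on all three side
   lines: they are linear in the direction of the side. *)
Lemma miquel_cotangents_opposite (A B C O A1 A2 B1 B2 C1 C2 P Q : point) (t s : R) :
  anticlockwise A B C ->
  dot O A1 B C + dot O A2 B C = 0 ->
  dot O B1 C A + dot O B2 C A = 0 ->
  dot O C1 A B + dot O C2 A B = 0 ->
  dot P A1 B C = t * cross B C B P -> dot Q A2 B C = s * cross B C B Q ->
  dot P B1 C A = t * cross C A C P -> dot Q B2 C A = s * cross C A C Q ->
  dot P C1 A B = t * cross A B A P -> dot Q C2 A B = s * cross A B A Q ->
  s = - t.
Proof.
  unfold anticlockwise; intros h mA mB mC p1 q1 p2 q2 p3 q3.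
  (* The side vectors sum to zero, so adding all six relations cancels every dot product and leaves
     [s + t] times the doubled area. *)
  assert ((s + t) * cross A B A C = 0) by (clear h; coords; nsatz).
  nra.
Qed.

(** * The lines through P and Q and their intersections *)

(** Eliminates [D]: as [cross Y Z P D = - cross Y Z Y P], the vector PD satisfies this homogeneous
    equation, hence so does the parallel vector PT. *)
Lemma on_line_through_miquel (Y Z D P T : point) (t : R) :
  on_line Y Z D -> cross Y Z Y P <> 0 -> dot P D Y Z = t * cross Y Z Y P ->
  on_line P D T -> t * cross Y Z P T + dot Y Z P T = 0.
Proof.
  intros l hx hd hT.
  apply Rmult_eq_reg_l with (2 := hx); rewrite Rmult_0_r.
  clear hx; coords; nsatz.
Qed.

(** The sum of the two line equations involves the unknown point only through its dot product with
    [(ux, uy)], their difference only through the cross product. *)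
Lemma intersection_coordinates (ux uy px py qx qy x y t : R) :
  t * (ux * (y - py) - uy * (x - px)) + (ux * (x - px) + uy * (y - py)) = 0 ->
  - t * (ux * (y - qy) - uy * (x - qx)) + (ux * (x - qx) + uy * (y - qy)) = 0 ->
  let cr := ux * (qy - py) - uy * (qx - px) in
  let dt := ux * (qx - px) + uy * (qy - py) in
  2 * t * (ux ^ 2 + uy ^ 2) * x =
    t * (ux ^ 2 + uy ^ 2) * (px + qx) - t ^ 2 * ux * cr + uy * dt /\
  2 * t * (ux ^ 2 + uy ^ 2) * y =
    t * (ux ^ 2 + uy ^ 2) * (py + qy) - t ^ 2 * uy * cr - ux * dt.
Proof.
  intros h1 h2 cr dt.
  pose proof (f_equal2 Rplus h1 h2) as hs.
  pose proof (f_equal2 Rminus h1 h2) as hd.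
  pose proof (f_equal2 (fun v w => ux * t * v - uy * w) hs hd) as hx.
  pose proof (f_equal2 (fun v w => uy * t * v + ux * w) hs hd) as hy.
  simpl in hx, hy; unfold cr, dt; split; lra.
Qed.

(* In complex notation, with [d] the vector [PQ], the right-hand sides are the
   coordinates of [- (1 + t^2) cross(u, v) * (conj d * u * v)]. *)
Lemma intersection_difference
  (ux uy vx vy px py qx qy sx sy rx ry t : R) :
  t * (ux * (sy - py) - uy * (sx - px)) + (ux * (sx - px) + uy * (sy - py)) = 0 ->
  - t * (ux * (sy - qy) - uy * (sx - qx)) + (ux * (sx - qx) + uy * (sy - qy)) = 0 ->
  t * (vx * (ry - py) - vy * (rx - px)) + (vx * (rx - px) + vy * (ry - py)) = 0 ->
  - t * (vx * (ry - qy) - vy * (rx - qx)) + (vx * (rx - qx) + vy * (ry - qy)) = 0 ->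
  2 * t * (ux ^ 2 + uy ^ 2) * (vx ^ 2 + vy ^ 2) * (sx - rx) =
    - (1 + t ^ 2) * (ux * vy - uy * vx) *
    ((qx - px) * (ux * vx - uy * vy) + (qy - py) * (ux * vy + uy * vx)) /\
  2 * t * (ux ^ 2 + uy ^ 2) * (vx ^ 2 + vy ^ 2) * (sy - ry) =
    - (1 + t ^ 2) * (ux * vy - uy * vx) *
    ((qx - px) * (ux * vy + uy * vx) - (qy - py) * (ux * vx - uy * vy)).
Proof.
  intros h1 h2 h3 h4.
  destruct (intersection_coordinates _ _ _ _ _ _ _ _ _ h1 h2) as [e1 e2].
  destruct (intersection_coordinates _ _ _ _ _ _ _ _ _ h3 h4) as [e3 e4].
  clear h1 h2 h3 h4; split.
  (* The midpoint of PQ, present in both intersection points, cancels. *)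
  - transitivity ((vx ^ 2 + vy ^ 2) * (2 * t * (ux ^ 2 + uy ^ 2) * sx) -
      (ux ^ 2 + uy ^ 2) * (2 * t * (vx ^ 2 + vy ^ 2) * rx)); [ring |].
    rewrite e1, e3; ring.
  - transitivity ((vx ^ 2 + vy ^ 2) * (2 * t * (ux ^ 2 + uy ^ 2) * sy) -
      (ux ^ 2 + uy ^ 2) * (2 * t * (vx ^ 2 + vy ^ 2) * ry)); [ring |].
    rewrite e2, e4; ring.
Qed.

(** * The isogonal conjugate of the point at infinity of PQ *)

(* In complex notation: [a b c conj(g) = r conj(a) g] for [g = (a - c)(b - a)]. *)
Lemma chord_product (ax ay bx by_ cx cy r : R) :
  ax ^ 2 + ay ^ 2 = r -> bx ^ 2 + by_ ^ 2 = r -> cx ^ 2 + cy ^ 2 = r ->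
  let p := ax * bx * cx - ax * by_ * cy - ay * bx * cy - ay * by_ * cx in
  let q := ay * bx * cx + ax * by_ * cx + ax * bx * cy - ay * by_ * cy in
  let m := (ax - cx) * (bx - ax) - (ay - cy) * (by_ - ay) in
  let k := (ax - cx) * (by_ - ay) + (ay - cy) * (bx - ax) in
  p * m + q * k = r * (ax * m + ay * k) /\ q * m - p * k = r * (ax * k - ay * m).
Proof.
  intros ha hb hc p q m k; unfold p, q, m, k; clear p q m k.
  split; apply Rminus_diag_uniq.
  (* On the circle conjugation acts as z -> r / z; this combination of the three circle equations
     encodes that without division. *)
  - transitivity
      ((ax * (bx ^ 2 + by_ ^ 2) - bx * (ax ^ 2 + ay ^ 2)) * (r - (cx ^ 2 + cy ^ 2)) +
       (cx * (ax ^ 2 + ay ^ 2) - ax * r) * ((bx ^ 2 + by_ ^ 2) - r) -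
       ((bx * cx - by_ * cy) * ax + (bx * cy + by_ * cx) * ay - r * ax)
         * ((ax ^ 2 + ay ^ 2) - r)); [ring |].
    rewrite ha, hb, hc; ring.
  - transitivity
      ((ay * (bx ^ 2 + by_ ^ 2) - by_ * (ax ^ 2 + ay ^ 2)) * (r - (cx ^ 2 + cy ^ 2)) +
       (cy * (ax ^ 2 + ay ^ 2) - ay * r) * ((bx ^ 2 + by_ ^ 2) - r) -
       ((bx * cy + by_ * cx) * ax - (bx * cx - by_ * cy) * ay - r * ay)
         * ((ax ^ 2 + ay ^ 2) - r)); [ring |].
    rewrite ha, hb, hc; ring.
Qed.

(* For [|a| = |b| = |c| = r] the point [x = - a b c (conj d)^2 / (|d|^2 r^2)]
   lies on the line through [a] with direction [conj d * (a - c) * (b - a)]. *)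
Lemma isogonal_line (ax ay bx by_ cx cy dx dy n r x y : R) :
  r <> 0 -> n <> 0 ->
  ax ^ 2 + ay ^ 2 = r -> bx ^ 2 + by_ ^ 2 = r -> cx ^ 2 + cy ^ 2 = r ->
  dx ^ 2 + dy ^ 2 = n ->
  let p := ax * bx * cx - ax * by_ * cy - ay * bx * cy - ay * by_ * cx in
  let q := ay * bx * cx + ax * by_ * cx + ax * bx * cy - ay * by_ * cy in
  n * r * x = - (p * (dx ^ 2 - dy ^ 2) + 2 * q * dx * dy) ->
  n * r * y = - (q * (dx ^ 2 - dy ^ 2) - 2 * p * dx * dy) ->
  let m := (ax - cx) * (bx - ax) - (ay - cy) * (by_ - ay) in
  let k := (ax - cx) * (by_ - ay) + (ay - cy) * (bx - ax) in
  (dx * m + dy * k) * (y - ay) - (dx * k - dy * m) * (x - ax) = 0.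
Proof.
  intros hr hn ha hb hc hd p q hx hy m k.
  apply Rmult_eq_reg_l with (r := n * r); [| now apply Rmult_integral_contrapositive].
  destruct (chord_product ax ay bx by_ cx cy r ha hb hc) as [e1 e2].
  fold p q m k in e1, e2; clearbody p q m k; clear - hx hy e1 e2 hd.
  transitivity ((dx * m + dy * k) * (n * r * y - n * r * ay)
    - (dx * k - dy * m) * (n * r * x - n * r * ax)); [ring |].
  rewrite hx, hy; subst n.
  transitivity ((dx ^ 2 + dy ^ 2) *
    (dy * ((p * m + q * k) - r * (ax * m + ay * k))
     - dx * ((q * m - p * k) - r * (ax * k - ay * m)))); [ring |].
  rewrite e1, e2; ring.
Qed.

Lemma circumcenter_exists (A B C : point) :
  anticlockwise A B C ->
  exists K r, 0 < r /\ dot K A K A = r /\ dot K B K B = r /\ dot K C K C = r.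
Proof.
  intro h; destruct (triangle_sides_neq A B C h) as [_ [_ nAB]].
  unfold anticlockwise in h; apply Rgt_not_eq in h.
  (* Cramer's rule for two perpendicular bisectors, with [A] as origin. *)
  set (kx := (dot A B A B * (py C - py A) - dot A C A C * (py B - py A))
             / (2 * cross A B A C)).
  set (ky := (dot A C A C * (px B - px A) - dot A B A B * (px C - px A))
             / (2 * cross A B A C)).
  set (K := Point (px A + kx) (py A + ky)).
  assert (hB : dot K B K B = dot K A K A)
    by (unfold K, kx, ky; coords; field; exact h).
  assert (hC : dot K C K C = dot K A K A)
    by (unfold K, kx, ky; coords; field; exact h).
  exists K, (dot K A K A); repeat split; trivial.
  apply dot_self_pos; intro e; rewrite e in hB.
  apply dot_self_pos in nAB; rewrite hB in nAB; coords; lra.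
Qed.

(* Real and imaginary parts of [(A - K) (B - K) (C - K)] in the complex plane. *)
Definition prod_re (K A B C : point) : R :=
  (px A - px K) * (px B - px K) * (px C - px K)
  - (px A - px K) * (py B - py K) * (py C - py K)
  - (py A - py K) * (px B - px K) * (py C - py K)
  - (py A - py K) * (py B - py K) * (px C - px K).

Definition prod_im (K A B C : point) : R :=
  (py A - py K) * (px B - px K) * (px C - px K)
  + (px A - px K) * (py B - py K) * (px C - px K)
  + (px A - px K) * (px B - px K) * (py C - py K)
  - (py A - py K) * (py B - py K) * (py C - py K).

(* [X] is the isogonal conjugate of the point at infinity of [PQ]: with complex
   coordinates from the circumcentre [K] and [d = Q - P],
   [X = - a b c (conj d)^2 / (|d|^2 r)], where [r] is the squared circumradius. *)
Definition isogonal_infinity (K A B C P Q : point) (r : R) (X : point) : Prop :=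
  dot P Q P Q * r * (px X - px K) =
    - (prod_re K A B C * ((px Q - px P) ^ 2 - (py Q - py P) ^ 2)
       + 2 * prod_im K A B C * (px Q - px P) * (py Q - py P)) /\
  dot P Q P Q * r * (py X - py K) =
    - (prod_im K A B C * ((px Q - px P) ^ 2 - (py Q - py P) ^ 2)
       - 2 * prod_re K A B C * (px Q - px P) * (py Q - py P)).

(** Only the symmetric product abc enters, which is why one point serves all three vertices. *)
Lemma isogonal_infinity_rotate (K A B C P Q : point) (r : R) (X : point) :
  isogonal_infinity K A B C P Q r X -> isogonal_infinity K B C A P Q r X.
Proof.
  intros [hx hy]; split; [rewrite hx | rewrite hy];
    unfold prod_re, prod_im; ring.
Qed.

(** Taking moduli, |abc|^2 = r^3 and |d|^4 cancels, which leaves |X|^2 = r. *)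
Lemma isogonal_infinity_exists (K A B C P Q : point) (r : R) :
  P <> Q -> 0 < r ->
  dot K A K A = r -> dot K B K B = r -> dot K C K C = r ->
  exists X, isogonal_infinity K A B C P Q r X /\ dot K X K X = r.
Proof.
  intros hPQ hr hA hB hC.
  apply dot_self_pos, Rgt_not_eq in hPQ; apply Rgt_not_eq in hr.
  set (x := - (prod_re K A B C * ((px Q - px P) ^ 2 - (py Q - py P) ^ 2)
       + 2 * prod_im K A B C * (px Q - px P) * (py Q - py P))
       / (dot P Q P Q * r)).
  set (y := - (prod_im K A B C * ((px Q - px P) ^ 2 - (py Q - py P) ^ 2)
       - 2 * prod_re K A B C * (px Q - px P) * (py Q - py P))
       / (dot P Q P Q * r)).
  exists (Point (px K + x) (py K + y)); split.
  - unfold isogonal_infinity; simpl; unfold x, y; split; field; tauto.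
  - assert (h : prod_re K A B C ^ 2 + prod_im K A B C ^ 2 = r ^ 3).
    { transitivity (dot K A K A * dot K B K B * dot K C K C).
      - unfold prod_re, prod_im, dot; ring.
      - rewrite hA, hB, hC; ring. }
    assert (hd : dot P Q P Q = (px Q - px P) ^ 2 + (py Q - py P) ^ 2)
      by (unfold dot; ring).
    transitivity ((prod_re K A B C ^ 2 + prod_im K A B C ^ 2)
      * ((px Q - px P) ^ 2 + (py Q - py P) ^ 2) ^ 2 / (dot P Q P Q * r) ^ 2).
    + unfold dot at 1; simpl; unfold x, y; field; tauto.
    + rewrite h, <- hd; field; tauto.
Qed.

(** * The three parallels and their common point *)

(** The vector from [TC] to [TB] and the vector AX are both real multiples of conj(PQ) * CA * AB,
    called [(gx, gy)] in the proof: the first by [intersection_difference], the second by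
    [isogonal_line]. *)
Lemma parallel_through_vertex
  (A B C K P Q TB TC X : point) (r t : R) :
  anticlockwise A B C -> P <> Q -> t <> 0 -> 0 < r ->
  dot K A K A = r -> dot K B K B = r -> dot K C K C = r ->
  isogonal_infinity K A B C P Q r X ->
  t * cross C A P TB + dot C A P TB = 0 ->
  - t * cross C A Q TB + dot C A Q TB = 0 ->
  t * cross A B P TC + dot A B P TC = 0 ->
  - t * cross A B Q TC + dot A B Q TC = 0 ->
  on_parallel_through A TB TC X.
Proof.
  intros h hPQ ht hr hA hB hC [hx hy] b1 b2 c1 c2.
  destruct (triangle_sides_neq A B C h) as [_ [nCA nAB]].
  apply dot_self_pos, Rgt_not_eq in hPQ, nCA, nAB.
  apply Rgt_not_eq in hr.
  destruct (intersection_difference _ _ _ _ _ _ _ _ _ _ _ _ _ b1 b2 c1 c2)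
    as [ex ey].
  pose proof (isogonal_line (px A - px K) (py A - py K) (px B - px K)
    (py B - py K) (px C - px K) (py C - py K) (px Q - px P) (py Q - py P)
    (dot P Q P Q) r (px X - px K) (py X - py K) hr hPQ) as hl.
  cbv zeta in hl; fold (prod_re K A B C) (prod_im K A B C) in hl.
  specialize (hl ltac:(rewrite <- hA; unfold dot; ring)
    ltac:(rewrite <- hB; unfold dot; ring)
    ltac:(rewrite <- hC; unfold dot; ring) ltac:(unfold dot; ring) hx hy).
  set (gx := (px Q - px P) * ((px A - px C) * (px B - px A)
                              - (py A - py C) * (py B - py A))
           + (py Q - py P) * ((px A - px C) * (py B - py A)
                              + (py A - py C) * (px B - px A))) in *.
  set (gy := (px Q - px P) * ((px A - px C) * (py B - py A)
                              + (py A - py C) * (px B - px A))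
           - (py Q - py P) * ((px A - px C) * (px B - px A)
                              - (py A - py C) * (py B - py A))) in *.
  assert (hg : gx * (py X - py A) - gy * (px X - px A) = 0)
    by (rewrite <- hl; unfold gx, gy; ring).
  assert (hgn : gx ^ 2 + gy ^ 2 = dot P Q P Q * dot C A C A * dot A B A B)
    by (unfold gx, gy, dot; ring).
  set (w := 2 * t * ((px A - px C) ^ 2 + (py A - py C) ^ 2)
            * ((px B - px A) ^ 2 + (py B - py A) ^ 2)) in *.
  assert (hw : w <> 0).
  { replace w with (2 * t * dot C A C A * dot A B A B) by (unfold w, dot; ring).
    repeat apply Rmult_integral_contrapositive_currified; trivial; lra. }
  set (v := - (1 + t ^ 2) * ((px A - px C) * (py B - py A)
                             - (py A - py C) * (px B - px A))) in *.
  assert (hv : v <> 0).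
  { replace v with (- (1 + t ^ 2) * cross A B A C) by (unfold v, cross; ring).
    unfold anticlockwise in h; apply Rmult_integral_contrapositive_currified;
      [pose proof (pow2_ge_0 t) |]; lra. }
  clearbody gx gy w v; split.
  (* If [TB = TC], then [(gx, gy)] vanishes, although its squared length is the product of those of
     PQ, CA and AB. *)
  - intro e; rewrite e, Rminus_diag, Rmult_0_r in ex, ey.
    symmetry in ex, ey.
    apply Rmult_integral in ex, ey.
    assert (gx = 0) by tauto. assert (gy = 0) by tauto. subst gx gy.
    symmetry in hgn.
    replace (0 ^ 2 + 0 ^ 2) with 0 in hgn by ring.
    apply Rmult_integral in hgn; destruct hgn as [hgn|]; [|tauto].
    apply Rmult_integral in hgn; tauto.
  - apply Rmult_eq_reg_l with (2 := hw); unfold cross.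
    transitivity (- (w * (px TB - px TC)) * (py X - py A)
                  + (w * (py TB - py TC)) * (px X - px A)); [ring |].
    rewrite ex, ey.
    transitivity (- v * (gx * (py X - py A) - gy * (px X - px A))); [ring |].
    rewrite hg; ring.
Qed.

Theorem proposition4p2
  (A B C : point) (Gamma : circle) (O : point)
  (A1 A2 B1 B2 C1 C2 P Q TA TB TC : point)
  (hABC : anticlockwise A B C)
  (hO : center Gamma = O)
  (hA : meets_line_at Gamma B C A1 A2)
  (hB : meets_line_at Gamma C A B1 B2)
  (hC : meets_line_at Gamma A B C1 C2)
  (hnd1 : nondegenerate_circles A B C A1 B1 C1)
  (hnd2 : nondegenerate_circles A B C A2 B2 C2)
  (hP : is_miquel_point A B C A1 B1 C1 P)
  (hQ : is_miquel_point A B C A2 B2 C2 Q)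
  (hPQ : P <> Q)
  (hP1 : P <> A1 /\ P <> B1 /\ P <> C1)
  (hQ2 : Q <> A2 /\ Q <> B2 /\ Q <> C2)
  (hTA : is_intersection P A1 Q A2 TA)
  (hTB : is_intersection P B1 Q B2 TB)
  (hTC : is_intersection P C1 Q C2 TC) :
  exists (w : circle) (X : point),
    is_circumcircle A B C w /\ on_circle w X /\
    on_parallel_through A TB TC X /\
    on_parallel_through B TC TA X /\
    on_parallel_through C TA TB X.
Proof.
  destruct (triangle_sides_neq A B C hABC) as [nBC [nCA nAB]].
  destruct hP1 as [nP1 [nP2 nP3]], hQ2 as [nQ1 [nQ2 nQ3]].
  pose proof hP as [lA1 [lB1 [lC1 _]]].
  pose proof hQ as [lA2 [lB2 [lC2 _]]].
  destruct (miquel_cotangent _ _ _ _ _ _ _ hABC hP nP1 nP2 nP3)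
    as [t [[pa1 pa2] [[pb1 pb2] [pc1 pc2]]]].
  destruct (miquel_cotangent _ _ _ _ _ _ _ hABC hQ nQ1 nQ2 nQ3)
    as [s [[qa1 qa2] [[qb1 qb2] [qc1 qc2]]]].
  pose proof (meets_line_at_midpoint _ _ _ _ _ nBC hA) as mA.
  pose proof (meets_line_at_midpoint _ _ _ _ _ nCA hB) as mB.
  pose proof (meets_line_at_midpoint _ _ _ _ _ nAB hC) as mC.
  rewrite hO in mA, mB, mC.
  pose proof (miquel_cotangents_opposite _ _ _ _ _ _ _ _ _ _ _ _ _ _
    hABC mA mB mC pa2 qa2 pb2 qb2 pc2 qc2) as hs.
  subst s.
  destruct hTA as [_ [_ [npar [tA1 tA2]]]].
  destruct hTB as [_ [_ [_ [tB1 tB2]]]].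
  destruct hTC as [_ [_ [_ [tC1 tC2]]]].
  (* For [t = 0] both PA1 and QA2 would be perpendicular to BC, hence parallel. *)
  assert (ht : t <> 0).
  { intros ->; apply npar.
    apply dot_self_pos, Rgt_not_eq in nBC.
    apply Rmult_eq_reg_l with (2 := nBC).
    clear - pa2 qa2; coords; nsatz. }
  pose proof (on_line_through_miquel _ _ _ _ _ _ lA1 pa1 pa2 tA1) as eA1.
  pose proof (on_line_through_miquel _ _ _ _ _ _ lA2 qa1 qa2 tA2) as eA2.
  pose proof (on_line_through_miquel _ _ _ _ _ _ lB1 pb1 pb2 tB1) as eB1.
  pose proof (on_line_through_miquel _ _ _ _ _ _ lB2 qb1 qb2 tB2) as eB2.
  pose proof (on_line_through_miquel _ _ _ _ _ _ lC1 pc1 pc2 tC1) as eC1.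
  pose proof (on_line_through_miquel _ _ _ _ _ _ lC2 qc1 qc2 tC2) as eC2.
  destruct (circumcenter_exists A B C hABC) as [K [r [hr [kA [kB kC]]]]].
  destruct (isogonal_infinity_exists K A B C P Q r hPQ hr kA kB kC)
    as [X [hX kX]].
  exists (Circle K (sqrt r) (sqrt_lt_R0 r hr)), X.
  assert (hon : forall Y, dot K Y K Y = r ->
            on_circle (Circle K (sqrt r) (sqrt_lt_R0 r hr)) Y).
  { intros Y hY; apply on_circle_sqr; simpl center; simpl radius.
    rewrite pow2_sqrt; lra. }
  assert (hBCA : anticlockwise B C A)
    by (unfold anticlockwise in *; coords; lra).
  assert (hCAB : anticlockwise C A B)
    by (unfold anticlockwise in *; coords; lra).
  pose proof (isogonal_infinity_rotate _ _ _ _ _ _ _ _ hX) as hX'.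
  pose proof (isogonal_infinity_rotate _ _ _ _ _ _ _ _ hX') as hX''.
  split; [unfold is_circumcircle; auto |].
  split; [auto |].
  split; [| split].
  - now apply (parallel_through_vertex A B C K P Q TB TC X r t).
  - now apply (parallel_through_vertex B C A K P Q TC TA X r t).
  - now apply (parallel_through_vertex C A B K P Q TA TB X r t).
Qed.
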